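(* Let $(X,\mathcal{E})$ and $(Y,\mathcal{F})$ be two coarse spaces ($X,Y$ non-empty), let $\mathcal{I},\mathcal{J}$ be upward directed sets with zeros, and suppose that $\mathbf{d}_X$ is a coarse $\mathcal{I}$-metric on $X$ and $\mathbf{d}_Y$ is a coarse $\mathcal{J}$-metric on $Y$ that induce the underlying coarse structures, i.e. $\mathcal{E}=\mathcal{E}_{\mathbf{d}_X}$ and $\mathcal{F}=\mathcal{E}_{\mathbf{d}_Y}$. Let $f,g:X\to Y$ be two maps. (a) $(X,\mathcal{E})$ is coarsely connected if and only if the largest element $\infty\in\mathcal{I}_\infty$ does not belong to $\mathbf{d}_X(X\times X)$. (b) $B\subseteq X$ is bounded if and only if one can find $(x,\alpha)\in X\times\mathcal{I}$ with $B\subseteq\mathbf{D}(x,\alpha)$. (c) If $\mathcal{J}$ is meet-complete, then $f$ is bornologous if and only if $\mathbf{d}_Y\circ(f\times f)\preceq\mathbf{d}_X$. (d) $f$ is proper if and only if there is a map $\Upsilon:Y\times\mathcal{J}\to X\times\mathcal{I}$ with $f^{-1}(\mathbf{D}(y,\beta))\subseteq\mathbf{D}(\Upsilon(y,\beta))$ for each $(y,\beta)\in Y\times\mathcal{J}$. (e) If $\mathcal{I}$ is meet-complete, then $f$ is effectively proper if and only if $\mathbf{d}_X\preceq\mathbf{d}_Y\circ(f\times f)$. (f) $f$ and $g$ are close if and only if there exists $\beta\in\mathcal{J}$ with $\mathbf{d}_Y(f(x),g(x))\le\beta$ for all $x\in X$.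
   Context: $\mathcal{P}_0(X\times X)$ is the collection of non-empty subsets of $X\times X$; $\Delta_X=\{(x,x):x\in X\}$; for $A,B\subseteq X\times X$: $A^{-1}=\{(y,x):(x,y)\in A\}$, $A\circ B=\{(x,z):\exists y\in X,\ (x,y)\in A,\ (y,z)\in B\}$, and $B[x]=\{y:(x,y)\in B\}$. A coarse structure on $X$ is a collection $\mathcal{E}\subseteq\mathcal{P}_0(X\times X)$ with $\Delta_X\in\mathcal{E}$ that is closed under the formation of (non-empty) subsets, inverses, products $\circ$ (whenever non-empty) and finite unions; $(X,\mathcal{E})$ is then a coarse space. A subcollection $\mathcal{B}\subseteq\mathcal{E}$ is a base for $\mathcal{E}$ if every element of $\mathcal{E}$ is contained in an element of $\mathcal{B}$. A partially ordered set is upward directed if any two elements have an upper bound in it, and meet-complete if every non-empty subset has a greatest lower bound in it; its zero is its smallest element. $\mathcal{I}_\infty$ is $\mathcal{I}$ with a new element $\infty$ adjoined that is strictly larger than all elements of $\mathcal{I}$; for $\Lambda:\mathcal{I}\to\mathcal{J}$, $\Lambda_\infty:\mathcal{I}_\infty\to\mathcal{J}_\infty$ is its extension with $\Lambda_\infty(\infty)=\infty$. For $\mathbf{d}:X\times X\to\mathcal{I}_\infty$ and $\alpha\in\mathcal{I}$ put $\mathbf{D}_\alpha=\{(x,y):\mathbf{d}(x,y)\le\alpha\}$ and $\mathbf{D}(z,\alpha)=\mathbf{D}_\alpha[z]$ (in the claim, balls in $X$ are formed with $\mathbf{d}_X$ and balls in $Y$ with $\mathbf{d}_Y$). $\mathbf{d}$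 is a coarse $\mathcal{I}$-metric if $\mathbf{d}(x,x)=0_{\mathcal{I}}$, $\mathbf{d}(x,y)=\mathbf{d}(y,x)$ for all $x,y$, and there is $\Phi:\mathcal{I}\to\mathcal{I}$ with $\mathbf{D}_\alpha\circ\mathbf{D}_\alpha\subseteq\mathbf{D}_{\Phi(\alpha)}$ for all $\alpha\in\mathcal{I}$. $\mathcal{E}_{\mathbf{d}}$ is the coarse structure having $\{\mathbf{D}_\alpha:\alpha\in\mathcal{I}\}$ as a base. For a coarse $\mathcal{I}$-metric $\mathbf{d}$ and a coarse $\mathcal{I}'$-metric $\mathbf{d}'$ on the same set $X$, $\mathbf{d}\preceq\mathbf{d}'$ means that there is an increasing (order-preserving) map $\Gamma:\mathcal{I}'\to\mathcal{I}$ with $\mathbf{d}(x,y)\le\Gamma_\infty(\mathbf{d}'(x,y))$ for all $x,y\in X$. The map $\mathbf{d}_Y\circ(f\times f)$, $(x,y)\mapsto\mathbf{d}_Y(f(x),f(y))$, is a coarse $\mathcal{J}$-metric on $X$. $(X,\mathcal{E})$ is coarsely connected if $\{(x,y)\}\in\mathcal{E}$ for all $x,y\in X$. $B\subseteq X$ is bounded if $B\subseteq E[x]$ for some $E\in\mathcal{E}$ and $x\in X$. $f$ is bornologous if $(f\times f)(E)\in\mathcal{F}$ for all $E\in\mathcal{E}$; proper if $f^{-1}(B)$ is bounded for every bounded $B\subseteq Y$; effectively proper if for all $F\in\mathcal{F}$ the set $(f\times f)^{-1}(F)$ is empty or belongs to $\mathcal{E}$. $f$ and $g$ are close if $\{(f(x),g(x)):x\in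 X\}\in\mathcal{F}$. *)

(* Defs.v *)
From HB Require Import structures.
From mathcomp Require Import all_boot all_order.
From mathcomp Require Import unstable boolp classical_sets.

Set Implicit Arguments.
Unset Strict Implicit.
Unset Printing Implicit Defensive.

Import Order.TTheory.
Local Open Scope order_scope.
Local Open Scope classical_set_scope.

(* [B \; A] applies [A] first, so the product A o B (first a step in A, then
   a step in B) is written [B \; A]. *)
Record coarse_structure (X : Type) (E : set (set (X * X))) : Prop := {
  coarse_nonempty : forall A, E A -> A !=set0;
  coarse_diagonal : E diagonal;
  coarse_subset : forall A B, E B -> A `<=` B -> A !=set0 -> E A;
  coarse_inverse : forall A, E A -> E (A^-1)%relation;
  coarse_product : forall A B, E A -> E B ->
    (B \; A)%relation !=set0 -> E (B \; A)%relation;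
  coarse_union : forall A B, E A -> E B -> E (A `|` B)
}.

Definition coarse_base (X : Type) (B E : set (set (X * X))) : Prop :=
  B `<=` E /\ forall A, E A -> exists2 A', B A' & A `<=` A'.

Definition coarsely_connected (X : Type) (E : set (set (X * X))) : Prop :=
  forall x y : X, E [set (x, y)].

Definition coarsely_bounded (X : Type) (E : set (set (X * X))) (B : set X) :
  Prop := exists2 A, E A & exists x, B `<=` xsection A x.

Definition bornologous (X Y : Type) (E : set (set (X * X)))
    (F : set (set (Y * Y))) (f : X -> Y) : Prop :=
  forall A, E A -> F (map_pair f @` A).

Definition coarsely_proper (X Y : Type) (E : set (set (X * X)))
    (F : set (set (Y * Y))) (f : X -> Y) : Prop :=
  forall B, coarsely_bounded F B -> coarsely_bounded E (f @^-1` B).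

Definition effectively_proper (X Y : Type) (E : set (set (X * X)))
    (F : set (set (Y * Y))) (f : X -> Y) : Prop :=
  forall A, F A -> map_pair f @^-1` A = set0 \/ E (map_pair f @^-1` A).

Definition coarsely_close (X Y : Type) (F : set (set (Y * Y)))
    (f g : X -> Y) : Prop :=
  F (range (fun x => (f x, g x))).

Definition upward_directed (d : Order.disp_t) (I : porderType d) : Prop :=
  forall a b : I, exists c, a <= c /\ b <= c.

Definition meet_complete (d : Order.disp_t) (I : porderType d) : Prop :=
  forall A : set I, A !=set0 -> infimums A !=set0.

(* I with a new strictly largest element adjoined: [Some a] is the element [a]
   of I, and [None], which is also [\top], is the new element. *)
Definition with_top (I : Type) : Type := option I.

Definition map_top (I J : Type) (L : I -> J) : with_top I -> with_top J :=
  omap L.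

Definition le_top (d : Order.disp_t) (I : porderType d) : rel (with_top I) :=
  fun a b => match a, b with
             | _, None => true
             | None, Some _ => false
             | Some a', Some b' => a' <= b'
             end.

Lemma le_top_refl (d : Order.disp_t) (I : porderType d) :
  reflexive (@le_top d I).
Proof. by case=> /=. Qed.

Lemma le_top_anti (d : Order.disp_t) (I : porderType d) :
  antisymmetric (@le_top d I).
Proof. by move=> [a|] [b|] //= /le_anti ->. Qed.

Lemma le_top_trans (d : Order.disp_t) (I : porderType d) :
  transitive (@le_top d I).
Proof. by move=> [b|] [a|] [c|] //=; exact: le_trans. Qed.

Lemma le_top_None (d : Order.disp_t) (I : porderType d) (a : with_top I) :
  le_top a None.
Proof. by case: a. Qed.

HB.instance Definition _ (I : choiceType) := Choice.copy (with_top I) (option I).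
HB.instance Definition _ (d : Order.disp_t) (I : porderType d) :=
  Order.Le_isPOrder.Build d (with_top I)
    (@le_top_refl d I) (@le_top_anti d I) (@le_top_trans d I).
HB.instance Definition _ (d : Order.disp_t) (I : porderType d) :=
  Order.hasTop.Build d (with_top I) (@le_top_None d I).

Definition entourage_of (d : Order.disp_t) (I : porderType d) (X : Type)
    (dX : X * X -> with_top I) (a : I) : set (X * X) :=
  [set p | dX p <= (Some a : with_top I)].

Definition coarse_ball (d : Order.disp_t) (I : porderType d) (X : Type)
    (dX : X * X -> with_top I) (za : X * I) : set X :=
  xsection (entourage_of dX za.2) za.1.

Record coarse_metric (d : Order.disp_t) (I : bPOrderType d) (X : Type)
    (dX : X * X -> with_top I) : Prop := {
  coarse_metric_diag : forall x, dX (x, x) = Some \bot;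
  coarse_metric_sym : forall x y, dX (x, y) = dX (y, x);
  coarse_metric_triangle : exists Phi : I -> I, forall a,
    (entourage_of dX a \; entourage_of dX a)%relation
      `<=` entourage_of dX (Phi a)
}.

(* At most one coarse structure has a given base, so this says that E is the
   coarse structure having the entourages of dX as a base. *)
Definition metric_induces (d : Order.disp_t) (I : porderType d) (X : Type)
    (dX : X * X -> with_top I) (E : set (set (X * X))) : Prop :=
  coarse_structure E /\ coarse_base (range (entourage_of dX)) E.

Definition coarse_metric_le (d d' : Order.disp_t) (I : porderType d)
    (I' : porderType d') (X : Type)
    (dX : X * X -> with_top I) (dX' : X * X -> with_top I') : Prop :=
  exists2 G : I' -> I, {homo G : a b / a <= b} &
    forall p, dX p <= map_top G (dX' p).

(* Main.v *)
Require Import Defs.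
From mathcomp Require Import all_boot all_order.
From mathcomp Require Import unstable boolp classical_sets.

Import Order.TTheory.
Local Open Scope order_scope.
Local Open Scope classical_set_scope.

(** When a metric d induces a coarse structure, the controlled sets are exactly
the non-empty sets contained in some entourage D_a ([metric_induces_mem]), so
every coarse notion becomes a statement about the D_a.  For connectedness,
boundedness and closeness this is a direct translation: for instance {(x, y)}
lies in some D_a exactly when d(x, y) is not the top element.  For proper maps
one also chooses, for each ball of the codomain, a ball of the domain
containing its preimage.

Being bornologous and being effectively proper both say that every entourage
of one metric d' is contained in an entourage of another metric d, where the
metric of the codomain is pulled back along f.  A choice a |-> b with
D'_a contained in D_b need not be increasing.  Meet-completeness supplies a
canonical, increasing one, the infimum of all such b; this infimum is still
admissible, because for every pair in D'_a the value of d is a lower bound of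
the set of these b ([coarse_metric_leP]). *)

Lemma metric_induces_mem {d : Order.disp_t} {I : porderType d} {X : Type}
    {dX : X * X -> with_top I} {E : set (set (X * X))} :
  metric_induces dX E -> forall A : set (X * X),
  E A <-> A !=set0 /\ exists a, A `<=` entourage_of dX a.
Proof.
move=> [cE [sDE baseE]] A; split=> [EA|[A0 [a Aa]]].
  split; first exact: (coarse_nonempty cE EA).
  by have [_ [a _ <-] Aa] := baseE A EA; exists a.
by apply: (coarse_subset cE _ Aa A0); apply: sDE; exists a.
Qed.

Lemma metric_induces_entourage {d : Order.disp_t} {I : porderType d} {X : Type}
    {dX : X * X -> with_top I} {E : set (set (X * X))} :
  metric_induces dX E -> forall a, E (entourage_of dX a).
Proof. by move=> [_ [sDE _]] a; apply: sDE; exists a. Qed.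

(** The infimum over the set S a of the b with D'_a contained in D_b is
increasing in a because S a shrinks as a grows.  It dominates d on D'_a because
each value of d there is a lower bound of S a; this value is an element of I
since S a is non-empty. *)
Lemma coarse_metric_leP {d d' : Order.disp_t} {I : porderType d}
    {I' : porderType d'} {X : Type}
    (dX : X * X -> with_top I) (dX' : X * X -> with_top I') :
  meet_complete I ->
  coarse_metric_le dX dX' <->
  forall a, exists b, entourage_of dX' a `<=` entourage_of dX b.
Proof.
move=> Imeet; split=> [[G Ghomo leG] a|dX'_dX].
  exists (G a) => p; rewrite /entourage_of /= => le_pa.
  apply: le_trans (leG p) _.
  by move: le_pa; case: (dX' p) => [c|] // /Ghomo.
pose S a : set I := [set b | entourage_of dX' a `<=` entourage_of dX b].
have /choice[G infG] : forall a, exists g, infimums (S a) g.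
  by move=> a; apply: Imeet; have [b] := dX'_dX a; exists b.
exists G => [a a' le_aa'|p].
  apply: (infG a').2; move=> b Sb; apply: (infG a).1 => p pa.
  by apply: Sb; apply: le_trans pa _.
case E' : (dX' p) => [a|] /=; last exact: lex1.
have p_a : entourage_of dX' a p by rewrite /entourage_of /= E'.
case E : (dX p) => [c|]; last first.
  by have [b /(_ p p_a)] := dX'_dX a; rewrite /entourage_of /= E.
apply: (infG a).2 => b /(_ p p_a).
by rewrite /entourage_of /= E.
Qed.

Section InducedCoarseStructure.
Context {X : Type} {E : set (set (X * X))}.
Context {d : Order.disp_t}.

Lemma coarsely_connectedP {I : porderType d} {dX : X * X -> with_top I} :
  metric_induces dX E -> coarsely_connected E <-> ~ range dX \top.
Proof.
move=> indE; have memE := metric_induces_mem indE.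
split=> [conE [[x y] _ dxy]|Ntop x y].
  have /memE[_ [a /(_ (x, y) erefl)]] := conE x y.
  by rewrite /entourage_of /= dxy.
apply/(memE _); split; first by exists (x, y).
case dxy : (dX (x, y)) => [a|]; last by case: Ntop; exists (x, y).
by exists a => _ ->; rewrite /entourage_of /= dxy.
Qed.

Lemma coarsely_boundedP {I : porderType d} {dX : X * X -> with_top I} :
  metric_induces dX E -> forall B : set X,
  coarsely_bounded E B <-> exists p : X * I, B `<=` coarse_ball dX p.
Proof.
move=> indE B; split=> [[A EA [x Bx]]|[[x a] Bxa]].
  have /(metric_induces_mem indE)[_ [a Aa]] := EA.
  exists (x, a); apply: subset_trans Bx _.
  by rewrite /coarse_ball !xsectionE => y; exact: Aa.
by exists (entourage_of dX a); [exact: metric_induces_entourage|exists x].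
Qed.

Lemma coarsely_closeP {I : porderType d} {dX : X * X -> with_top I} {T : Type}
    (f g : T -> X) :
  [set: T] !=set0 -> metric_induces dX E ->
  coarsely_close E f g <->
  exists b, forall t, dX (f t, g t) <= (Some b : with_top I).
Proof.
move=> [t0 _] indE; have memE := metric_induces_mem indE.
split=> [/memE[_ [b fgb]]|[b fgb]].
  by exists b => t; apply: fgb; exists t.
apply/(memE _); split; first by exists (f t0, g t0), t0.
by exists b => _ [t _ <-]; exact: fgb.
Qed.

End InducedCoarseStructure.

Section CoarseMaps.
Context {X Y : Type} {E : set (set (X * X))} {F : set (set (Y * Y))}.
Context {dI dJ : Order.disp_t}.

Lemma bornologousP {I : porderType dI} {J : porderType dJ}
    {dX : X * X -> with_top I} {dY : Y * Y -> with_top J} (f : X -> Y) :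
  metric_induces dX E -> metric_induces dY F ->
  bornologous E F f <->
  forall a, exists b, entourage_of dX a `<=` entourage_of (dY \o map_pair f) b.
Proof.
move=> indE indF; have memF := metric_induces_mem indF; split=> [fborn a|fXY A].
  have /memF[_ [b fab]] := fborn _ (metric_induces_entourage indE a).
  by exists b => p pa; apply: fab; exists p.
move=> /(metric_induces_mem indE)[[p Ap] [a Aa]]; have [b ab] := fXY a.
apply/(memF _); split; first by exists (map_pair f p), p.
by exists b => _ [q Aq <-]; exact: ab (Aa q Aq).
Qed.

Lemma coarsely_properP {I : porderType dI} {J : porderType dJ}
    {dX : X * X -> with_top I} {dY : Y * Y -> with_top J} (f : X -> Y) :
  metric_induces dX E -> metric_induces dY F ->
  coarsely_proper E F f <->
  exists U : Y * J -> X * I, forall p,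
    f @^-1` coarse_ball dY p `<=` coarse_ball dX (U p).
Proof.
move=> indE indF; split=> [fprop|[U fU] B].
  suff /choice[U fU] : forall p : Y * J, exists q : X * I,
      f @^-1` coarse_ball dY p `<=` coarse_ball dX q by exists U.
  move=> p; apply/(coarsely_boundedP indE); apply: fprop.
  by apply/(coarsely_boundedP indF); exists p.
move=> /(coarsely_boundedP indF)[p Bp]; apply/(coarsely_boundedP indE).
by exists (U p) => x /Bp; exact: fU.
Qed.

(** An index set with a least element is non-empty: this is what bounds an
empty preimage by an entourage. *)
Lemma effectively_properP {I : bPOrderType dI} {J : porderType dJ}
    {dX : X * X -> with_top I} {dY : Y * Y -> with_top J} (f : X -> Y) :
  metric_induces dX E -> metric_induces dY F ->
  effectively_proper E F f <->
  forall b, exists a, entourage_of (dY \o map_pair f) b `<=` entourage_of dX a.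
Proof.
move=> indE indF; have memE := metric_induces_mem indE; split=> [feff b|fYX A].
  have [fb0|/memE[_ //]] := feff _ (metric_induces_entourage indF b).
  by exists \bot; rewrite [entourage_of _ b]fb0.
move=> /(metric_induces_mem indF)[_ [b Ab]].
have [->|/set0P fA0] := eqVneq (map_pair f @^-1` A) set0; [by left|right].
have [a ba] := fYX b; apply/(memE _); split=> //.
by exists a => p /Ab; exact: ba.
Qed.

End CoarseMaps.

Theorem proposition8 (X Y : Type)
    (X0 : [set: X] !=set0) (Y0 : [set: Y] !=set0)
    (E : set (set (X * X))) (F : set (set (Y * Y)))
    (coarseE : coarse_structure E) (coarseF : coarse_structure F)
    (dI dJ : Order.disp_t) (I : bPOrderType dI) (J : bPOrderType dJ)
    (directedI : upward_directed I) (directedJ : upward_directed J)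
    (dX : X * X -> with_top I) (dY : Y * Y -> with_top J)
    (metricX : coarse_metric dX) (metricY : coarse_metric dY)
    (inducesE : metric_induces dX E) (inducesF : metric_induces dY F)
    (f g : X -> Y) :
  (coarsely_connected E <-> ~ range dX \top) /\
  (forall B : set X, coarsely_bounded E B <->
     exists p : X * I, B `<=` coarse_ball dX p) /\
  (meet_complete J ->
     (bornologous E F f <-> coarse_metric_le (dY \o map_pair f) dX)) /\
  (coarsely_proper E F f <->
     exists U : Y * J -> X * I, forall p : Y * J,
       f @^-1` coarse_ball dY p `<=` coarse_ball dX (U p)) /\
  (meet_complete I ->
     (effectively_proper E F f <-> coarse_metric_le dX (dY \o map_pair f))) /\
  (coarsely_close F f g <->
     exists b : J, forall x, dY (f x, g x) <= (Some b : with_top J)).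
Proof.
split; first exact: coarsely_connectedP.
split; first exact: coarsely_boundedP.
split=> [Jmeet|].
  apply: iff_trans (bornologousP f inducesE inducesF) _.
  by apply: iff_sym; exact: coarse_metric_leP.
split; first exact: coarsely_properP.
split=> [Imeet|]; last exact: coarsely_closeP.
apply: iff_trans (effectively_properP f inducesE inducesF) _.
by apply: iff_sym; exact: coarse_metric_leP.
Qed.
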